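(* Let $R$ be a commutative ring, $I=(f_1,\dots,f_r)\subseteq R$ and $\mathfrak a=(a_1,\dots,a_s)\subseteq I$ ideals, and $\Phi=(c_{ij})$ an $r\times s$ matrix over $R$ with $a_j=\sum_{i=1}^r c_{ij}f_i$ for $1\le j\le s$. Let $\zeta_j=\sum_{i=1}^r c_{ij}e_i\in K_1(\mathbf f;R)$, let $\Gamma_\bullet$ be the $R$-subalgebra of $K_\bullet(\mathbf f;R)$ generated by $\zeta_1,\dots,\zeta_s$, and let $Z_\bullet=Z_\bullet(\mathbf f;R)$ be the subalgebra of Koszul cycles. Then the disguised residual intersection satisfies $$K(\mathbf a,\mathbf f,\Phi)=\langle\Gamma_\bullet\cdot Z_\bullet\rangle_r .$$
   Context: $K_\bullet(\mathbf f;R)$ is the Koszul complex of $\mathbf f=f_1,\dots,f_r$ viewed as a differential graded algebra: the exterior algebra over $R$ on $e_1,\dots,e_r$ with differential $\partial(e_i)=f_i$ extended as a graded derivation. $\langle\Gamma_\bullet\cdot Z_\bullet\rangle_r$ denotes the degree-$r$ component of the $R$-subalgebra of $K_\bullet$ generated by $\Gamma_\bullet$ and $Z_\bullet$ (the $R$-span of the products $\gamma\wedge z$ with $\gamma\in\Gamma_j$, $z\in Z_{r-j}$); it is identified with an ideal of $R$ via $K_r=R\,e_1\wedge\cdots\wedge e_r\cong R$. Disguised residual intersection: let $S=R[T_1,\dots,T_r]$ (standard grading), $\mathfrak t=(T_1,\dots,T_r)$, $\gamma_j=\sum_i c_{ij}T_i\in S_1$. Let $Z_k=Z_k(\mathbf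 f;R)$ and let $\mathcal Z_\bullet$ be the Herzog–Simis–Vasconcelos complex with $\mathcal Z_k=Z_k\otimes_R S(-k)$, whose differential is induced by the Koszul differential of $T_1,\dots,T_r$ (sending $e_i\mapsto T_i$). Let $\mathcal D_\bullet=\mathrm{Tot}(\mathcal Z_\bullet\otimes_S K_\bullet(\gamma_1,\dots,\gamma_s;S))$, so $\mathcal D_i\cong\bigoplus_k Z_k\otimes_R\bigwedge^{i-k}R^s\otimes_R S(-i)$. Consider the double complex $\mathcal D_\bullet\otimes_S\check C^\bullet_{\mathfrak t}(S)$, where $\check C^\bullet_{\mathfrak t}(S)$ is the Čech complex of $S$ with respect to $T_1,\dots,T_r$, and its two spectral sequences in internal degree $0$. Since $H^i_{\mathfrak t}(S)=0$ for $i\ne r$, the spectral sequence computing Čech cohomology first degenerates and yields a natural surjection $H^r_{\mathfrak t}(\mathcal D_r)_0\to H(\mathrm{Tot})_0$ (total index $0$), and the other spectral sequence yields the natural edge map from $H(\mathrm{Tot})_0$ onto its $E_\infty$-term contained in $(\mathcal D_0)_0=R$. The composite map $\tau_0:H^r_{\mathfrak t}(\mathcal D_r)_0\to R$ has as image an ideal of $R$, called the disguised residual intersection $K(\mathbf a,\mathbf f,\Phi)$. *)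

(* Defs.v *)
From HB Require Import structures.
From mathcomp Require Import all_boot all_order all_algebra.
Set Implicit Arguments. Unset Strict Implicit. Unset Printing Implicit Defensive.
Import Order.TTheory GRing.Theory Num.Theory.
Local Open Scope ring_scope.

(* ---------- Exterior algebra  /\ R^n  with basis e_I, I ⊆ {0..n-1} ---------- *)
Notation ext R n := {ffun {set 'I_n} -> R} (only parsing).

Definition escale (R : comPzRingType) (n : nat) (c : R) (u : ext R n) : ext R n :=
  [ffun I => c * u I].

Definition ebasis (R : comPzRingType) (n : nat) (I : {set 'I_n}) : ext R n :=
  [ffun K => ((K == I) : nat)%:R].

Definition below_count (n : nat) (I : {set 'I_n}) (l : 'I_n) : nat :=
  #|[set m in I | (m < l)%N]|.

(* e_I /\ e_J = wsign I J * e_(I ∪ J) for disjoint I, J *)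
Definition wsign (R : comPzRingType) (n : nat) (I J : {set 'I_n}) : R :=
  (-1) ^+ #|[set p : 'I_n * 'I_n | [&& p.1 \in I, p.2 \in J & (p.2 < p.1)%N]]|.

Definition wedge (R : comPzRingType) (n : nat) (u v : ext R n) : ext R n :=
  [ffun K : {set 'I_n} => \sum_(I : {set 'I_n} | I \subset K)
                wsign R I (K :\: I) * u I * v (K :\: I)].

(* Koszul differential of f: the derivation with e_l |-> f_l, i.e.
   d(e_{i_1} /\ ... /\ e_{i_k}) = sum_p (-1)^(p-1) f_{i_p} e_{... ^i_p ...} *)
Definition kdiff (R : comPzRingType) (n : nat) (f : 'I_n -> R) (u : ext R n)
  : ext R n :=
  [ffun I : {set 'I_n} => \sum_(l : 'I_n | l \notin I)
               (-1) ^+ below_count I l * f l * u (l |: I)].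

Definition homog (R : comPzRingType) (n : nat) (k : nat) (u : ext R n) : Prop :=
  forall I, u I != 0 -> #|I| = k.

Definition koszul_cycle (R : comPzRingType) (n : nat) (f : 'I_n -> R) (k : nat)
  (u : ext R n) : Prop := homog k u /\ kdiff f u = 0.

Inductive in_subalg (R : comPzRingType) (n : nat) (G : ext R n -> Prop)
  : ext R n -> Prop :=
| sa_gen u : G u -> in_subalg G u
| sa_one : in_subalg G (ebasis R set0)
| sa_add u v : in_subalg G u -> in_subalg G v -> in_subalg G (u + v)
| sa_scale (c : R) u : in_subalg G u -> in_subalg G (escale c u)
| sa_mul u v : in_subalg G u -> in_subalg G v -> in_subalg G (wedge u v).

Inductive in_span (R : comPzRingType) (n : nat) (P : ext R n -> Prop)
  : ext R n -> Prop :=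
| span0 : in_span P 0
| spanS (c : R) u v : P u -> in_span P v -> in_span P (escale c u + v).

Definition zeta (R : comPzRingType) (r s : nat) (Phi : 'M[R]_(r, s)) (j : 'I_s)
  : ext R r := \sum_(i < r) escale (Phi i j) (ebasis R [set i]).

Definition Gamma (R : comPzRingType) (r s : nat) (Phi : 'M[R]_(r, s)) (j : nat)
  (u : ext R r) : Prop :=
  in_subalg (fun v => exists j' : 'I_s, v = zeta Phi j') u /\ homog j u.

(* < Gamma . Z >_r, identified with an ideal of R via K_r = R e_{1..r} *)
Definition GammaZ_ideal (R : comPzRingType) (r s : nat) (f : 'I_r -> R)
  (Phi : 'M[R]_(r, s)) (y : R) : Prop :=
  exists v : ext R r,
    in_span (fun w => exists (j : nat) (u z : ext R r),
               [/\ (j <= r)%N, Gamma Phi j u, koszul_cycle f (r - j) z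
                 & w = wedge u z]) v
    /\ v setT = y.

(* Laurent exponents a in Z^r; S_sigma = R[T][T_sigma^-1] is the R-free module on
   the monomials T^a with a_l >= 0 for l ∉ sigma. *)
Definition expo (n : nat) := {ffun 'I_n -> int}.
Definition expo0 (n : nat) : expo n := [ffun => 0].
(* a - e_l : (T_l * g)(a) = g(a - e_l) *)
Definition shift (n : nat) (a : expo n) (l : 'I_n) : expo n :=
  [ffun m => a m - ((m == l) : nat)%:Z].

(* x sigma I J a = coefficient of  e_I ⊗ eps_J ⊗ T^a  in the Čech component
   indexed by sigma. *)
Definition dcx (R : comPzRingType) (r s : nat) :=
  {set 'I_r} -> {set 'I_r} -> {set 'I_s} -> expo r -> R.

(* total index 0 (Čech degree = homological degree), internal degree 0,
   and coefficients in S_sigma *)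
Definition well_placed (R : comPzRingType) (r s : nat) (x : dcx R r s) : Prop :=
  forall sigma I J a, x sigma I J a != 0 ->
    [/\ #|sigma| = (#|I| + #|J|)%N,
        \sum_(l < r) a l = - ((#|I| + #|J|)%N)%:Z
      & forall l, l \notin sigma -> 0 <= a l].

Definition fin_supp (R : comPzRingType) (r s : nat) (x : dcx R r s) : Prop :=
  exists S : seq (expo r), forall sigma I J a, x sigma I J a != 0 -> a \in S.

Definition Zvalued (R : comPzRingType) (r s : nat) (f : 'I_r -> R)
  (x : dcx R r s) : Prop :=
  forall sigma J a, kdiff f [ffun I => x sigma I J a] = 0.

(* differential of D = Z ⊗ S (HSV, e_l |-> T_l) ⊗ K(gamma;S),
   gamma_j = sum_l c_lj T_l *)
Definition Ddiff (R : comPzRingType) (r s : nat) (Phi : 'M[R]_(r, s))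
  (x : dcx R r s) : dcx R r s :=
  fun sigma I J a =>
    \sum_(l : 'I_r | l \notin I)
        (-1) ^+ below_count I l * x sigma (l |: I) J (shift a l)
  + (-1) ^+ #|I| *
    \sum_(j : 'I_s | j \notin J) (-1) ^+ below_count J j *
        \sum_(l < r) Phi l j * x sigma I (j |: J) (shift a l).

(* Čech differential (restriction maps are inclusions of Laurent coefficients) *)
Definition cech (R : comPzRingType) (r s : nat) (x : dcx R r s) : dcx R r s :=
  fun tau I J a =>
    \sum_(l : 'I_r | l \in tau) (-1) ^+ below_count tau l * x (tau :\ l) I J a.

(* Disguised residual intersection K(a,f,Phi) = image of tau_0 = image of the
   edge map H(Tot)_0 -> (D_0 ⊗ Č^0)_0 = R, i.e. the (0,0)-components of
   total cycles of total index 0 and internal degree 0. *)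
Definition disguised_ri (R : comPzRingType) (r s : nat) (f : 'I_r -> R)
  (Phi : 'M[R]_(r, s)) (y : R) : Prop :=
  exists x : dcx R r s,
    [/\ well_placed x, fin_supp x, Zvalued f x,
        (forall tau I J a, Ddiff Phi x tau I J a = cech x tau I J a)
      & x set0 set0 set0 (expo0 r) = y].

(* Main.v *)
(* The differential of the Koszul algebra K(T,gamma;S) is sum_l T_l d_l with
   anticommuting square-zero operators d_l, and eps_j |-> zeta_j defines a chain
   map K(T,gamma;S) -> K(T;S).  Under this map a total cycle x goes to a total
   cycle of K(T;S) (x) Cech, whose Z^r-multidegree 0 part consists of one scalar
   c_sigma at each e_sigma T^(-1_sigma); the cycle condition says
   c_(sigma + l) = c_sigma.  Hence the (0,0)-component c_0 of x equals c_[r],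
   which is the sum over J of the top coefficients of +-zeta_J z_J, where z_J is
   the cycle multiplying eps_J T^(-1,...,-1) in x.  Conversely any choice w of
   the z_J extends to a total cycle, with component at sigma
   +-T^(-1_sigma) (prod_(l notin sigma) d_l) w. *)

Require Import Defs.
From HB Require Import structures.
From mathcomp Require Import all_boot all_order all_algebra.
From mathcomp Require Import ring.
Import GRing.Theory.
Local Open Scope ring_scope.
Set Implicit Arguments. Unset Strict Implicit. Unset Printing Implicit Defensive.

(** * How many elements of a set lie below an index *)

Section BelowCount.
Variable n : nat.
Implicit Types (I K : {set 'I_n}) (l m : 'I_n).

Lemma below_countU1 I l m :
  l \notin I -> below_count (l |: I) m = ((l < m)%N + below_count I m)%N.
Proof.
move=> lI; rewrite /below_count.
have -> : [set k in l |: I | (k < m)%N] =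
    (if (l < m)%N then [set l] else set0) :|: [set k in I | (k < m)%N].
  apply/setP => k; case: ifP => lm; rewrite !inE; case: eqVneq => // -> //=.
  by rewrite lm andbF.
case: ifP => lm; last by rewrite set0U.
by rewrite cardsU1 !inE negb_and lI.
Qed.

Lemma below_countD1 I l m :
  l \in I -> below_count I m = ((l < m)%N + below_count (I :\ l) m)%N.
Proof. by move=> lI; rewrite -{1}(setD1K lI) below_countU1 // setD11. Qed.

Lemma below_countC I l : (below_count I l + below_count (~: I) l)%N = l.
Proof.
rewrite /below_count -cardsUI.
have -> : [set m in I | (m < l)%N] :&: [set m in ~: I | (m < l)%N] = set0.
  by apply/setP => m; rewrite !inE; case: (m \in I); rewrite ?andbF.
have -> : [set m in I | (m < l)%N] :|: [set m in ~: I | (m < l)%N]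
    = [set m : 'I_n | (m < l)%N].
  by apply/setP => m; rewrite !inE; case: (m \in I); rewrite ?orbF.
rewrite cards0 addn0 -sum1_card.
under eq_bigl => m do rewrite inE.
by rewrite (big_ord_narrow (ltnW (ltn_ord l))) /= sum1_card card_ord.
Qed.

End BelowCount.

(** * Signs acting on additive groups, and alternating sums *)

Definition sgn (V : zmodType) (k : nat) (v : V) : V := if odd k then - v else v.

Section Sgn.
Variables (V : zmodType).
Implicit Types v : V.

Lemma sgn0 k : sgn k (0 : V) = 0.
Proof. by rewrite /sgn oppr0 if_same. Qed.

Lemma sgnS k v : sgn k.+1 v = - sgn k v.
Proof. by rewrite /sgn /=; case: odd => /=; rewrite ?opprK. Qed.

Lemma sgn_sgn j k v : sgn j (sgn k v) = sgn (j + k) v.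
Proof. by rewrite /sgn oddD; case: odd; case: odd => /=; rewrite ?opprK. Qed.

Lemma raddf_sgn (U : zmodType) (h : {additive V -> U}) k v :
  h (sgn k v) = sgn k (h v).
Proof. by rewrite /sgn; case: odd; rewrite ?raddfN. Qed.

(** In characteristic 2 antisymmetry does not kill the diagonal, so its vanishing is a separate
    hypothesis. [F] is its part [G] above the diagonal minus the transpose of [G], and both have the
    same total. *)
Lemma sum_alternating n (F : 'I_n -> 'I_n -> V) :
    (forall i j, F i j = - F j i) -> (forall i, F i i = 0) ->
  \sum_i \sum_j F i j = 0.
Proof.
move=> FN F0; pose G (i j : 'I_n) := if (i < j)%N then F i j else 0.
rewrite (eq_bigr (fun i => \sum_j G i j - \sum_j G j i)) => [|i _].
  by rewrite sumrB [X in _ - X]exchange_big subrr.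
rewrite -sumrB; apply: eq_bigr => j _; rewrite /G.
case: ltngtP => [_|_|/val_inj <-]; rewrite ?subr0 ?sub0r ?F0 //.
Qed.

End Sgn.

Lemma sgnE (R : pzRingType) k (x : R) : sgn k x = (-1) ^+ k * x.
Proof. by rewrite /sgn -signr_odd; case: odd; rewrite ?mulN1r ?mul1r. Qed.

Lemma sgn_ffunE (T : finType) (V : zmodType) k (u : {ffun T -> V}) t :
  sgn k u t = sgn k (u t).
Proof. by rewrite /sgn; case: odd; rewrite ?ffunE. Qed.

(** * Ordered products of anticommuting operators *)

Section OrderedProduct.
Variables (V : zmodType) (n : nat) (T : 'I_n -> {additive V -> V}).
Implicit Types (A B : {set 'I_n}) (u : V) (s : seq 'I_n) (l m k : 'I_n).

(** The composite of the [T m], [m] in [A], smallest index outermost. Folding over a list with [A]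
    fixed allows induction on the tail of the enumeration. *)
Definition oprod_seq s A u : V :=
  foldr (fun m v => if m \in A then T m v else v) u s.

Definition oprod A u : V := oprod_seq (enum 'I_n) A u.

Let inc s := sorted (fun i j : 'I_n => (i < j)%N) s.

Lemma inc_enum : inc (enum 'I_n).
Proof. by have := iota_ltn_sorted 0 n; rewrite -val_enum_ord sorted_map. Qed.

Lemma inc_cons m s : inc (m :: s) -> inc s /\ {in s, forall l : 'I_n, (m < l)%N}.
Proof.
move=> /= ms; split; first exact: path_sorted ms.
by apply/allP; apply: order_path_min ms => x y z; apply: ltn_trans.
Qed.

Lemma count_below_count A l :
  count (fun m => (m \in A) && (m < l)%N) (enum 'I_n) = below_count A l.
Proof.
rewrite /below_count cardE size_filter enumT.
by apply: eq_count => m /=; rewrite inE.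
Qed.

Lemma eq_oprod_seq s A B u : {in s, A =i B} -> oprod_seq s A u = oprod_seq s B u.
Proof.
elim: s => //= m s IH AB.
rewrite AB ?mem_head // IH // => k ks.
by apply: AB; rewrite inE ks orbT.
Qed.

Lemma oprod0 u : oprod set0 u = u.
Proof. by rewrite /oprod; elim: (enum _) => //= m s ->; rewrite inE. Qed.

Fact oprod_is_additive A : zmod_morphism (oprod A).
Proof.
move=> u v; rewrite /oprod; elim: (enum _) => //= m s ->.
by case: ifP => // _; rewrite raddfB.
Qed.

Lemma oprod_morph (h : V -> V) A u :
  (forall l v, h (T l v) = T l (h v)) -> h (oprod A u) = oprod A (h u).
Proof.
move=> hT; rewrite /oprod; elim: (enum _) => //= m s <-.
by case: ifP.
Qed.

(** Here [P] is a graded property, such as homogeneity, whose degree each operator raises by one. *)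
Lemma oprod_ind (P : nat -> V -> Prop) A u d :
    (forall i l v, P i v -> P i.+1 (T l v)) -> P d u ->
  P (#|A| + d)%N (oprod A u).
Proof.
move=> PT Pu.
have -> : #|A| = count (mem A) (enum 'I_n).
  by rewrite cardE size_filter enumT.
rewrite /oprod; elim: (enum _) => //= m s IH.
by case: (m \in A) => //; apply: PT.
Qed.

Lemma oprod_closed (P : V -> Prop) A u :
  (forall l v, P v -> P (T l v)) -> P u -> P (oprod A u).
Proof.
move=> PT; apply: (oprod_ind (P := fun=> P) A (d := 0)) => _ l v.
exact: PT.
Qed.

Section Anticommuting.
Hypothesis TT : forall l m u, T l (T m u) = - T m (T l u).
Hypothesis TTl : forall l u, T l (T l u) = 0.

(** [T l] moves inwards past the factors of smaller index, one sign for each. It then meets another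
    [T l] and gives zero, or takes its place in the order. *)
Lemma oprod_act l A u :
  T l (oprod A u) =
    if l \in A then 0 else sgn (below_count A l) (oprod (l |: A) u).
Proof.
rewrite -count_below_count /oprod.
have : l \in enum 'I_n by rewrite mem_enum.
elim: (enum _) inc_enum => //= m s IH /inc_cons[incs ltms].
rewrite inE; case: eqVneq => [lm _|neq_lm /= ls].
  subst m; rewrite /= ltnn andbF setU11 add0n.
  case: ifP => [lA|lA]; first exact: TTl.
  (* The list increases, so nothing in the tail lies below its head [l] and no sign arises. *)
  rewrite (@eq_in_count _ _ pred0) ?count_pred0.
    congr (T l _); apply: eq_oprod_seq => k ks; rewrite !inE.
    by move: (ltms _ ks); case: eqVneq => // ->; rewrite ltnn.
  move=> k /ltms; rewrite /= ltnNge => /negbTE lk.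
  by rewrite ltn_neqAle lk !andbF.
rewrite !inE eq_sym (negbTE neq_lm) ltms // andbT /=.
case: (m \in A); last by rewrite IH.
rewrite TT IH //; case: (l \in A); first by rewrite raddf0 oppr0.
by rewrite raddf_sgn add1n sgnS.
Qed.
End Anticommuting.

Variables (C : {additive V -> V}) (K : 'I_n -> {additive V -> V}).
Hypothesis CT : forall m u, C (T m u) = K m u - T m (C u).
Hypothesis TK : forall l m u, T l (K m u) = K m (T l u).

(** A Leibniz rule: [C] is pushed through the product from the left, leaves [K l] in place of [T l]
    with the sign of the factors already crossed, and [K l] commutes out to the front. *)
Lemma oprod_derivation A u :
  C (oprod A u) = sgn #|A| (oprod A (C u))
    + \sum_(l in A) sgn (below_count A l) (K l (oprod (A :\ l) u)).
Proof.
have -> (G : 'I_n -> V) :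
    \sum_(l in A) G l = \sum_(l <- enum 'I_n | l \in A) G l.
  by rewrite big_enum_cond.
under eq_bigr => l _ do rewrite -count_below_count.
have -> : #|A| = count (mem A) (enum 'I_n).
  by rewrite cardE size_filter enumT.
rewrite /oprod; elim: (enum _) inc_enum => /= [|m s IH /inc_cons[incs ltms]].
  by rewrite big_nil addr0.
have mNs k : k \in s -> k != m.
  by move=> /ltms; case: eqVneq => // ->; rewrite ltnn.
(* Terms from the tail: a head factor [T m] raises each count by one, which is the sign in
   [- T m]. *)
have sum_eq : \sum_(l <- s | l \in A)
      sgn (((m \in A) && (m < l)%N) + count (fun k => (k \in A) && (k < l)%N) s)
        (K l (if m \in A :\ l then T m (oprod_seq s (A :\ l) u)
              else oprod_seq s (A :\ l) u)) =
    (if m \in A then - T m (\sum_(l <- s | l \in A)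
        sgn (count (fun k => (k \in A) && (k < l)%N) s) (K l (oprod_seq s (A :\ l) u)))
     else \sum_(l <- s | l \in A)
        sgn (count (fun k => (k \in A) && (k < l)%N) s) (K l (oprod_seq s (A :\ l) u))).
  case: ifP => mA.
    rewrite raddf_sum -sumrN big_seq_cond [RHS]big_seq_cond.
    apply: eq_bigr => l /andP[ls lA].
    by rewrite ltms //= !inE mA eq_sym mNs //= raddf_sgn TK sgnS.
  by apply: eq_bigr => l _; rewrite !inE mA andbF.
rewrite big_cons /= sum_eq !inE eqxx ltnn andbF add0n /=.
case: ifP => mA /=; last exact: IH.
rewrite CT IH // raddfD raddf_sgn opprD add1n sgnS.
rewrite addrCA; congr (_ + _).
rewrite (@eq_in_count _ _ pred0) ?count_pred0; last first.
  move=> k /ltms; rewrite /= ltnNge => /negbTE mk.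
  by rewrite ltn_neqAle mk !andbF.
congr (_ + _); congr (K m _); apply: eq_oprod_seq => k ks.
by rewrite !inE mNs.
Qed.

End OrderedProduct.

(** * Contraction and exterior multiplication *)

Section Operators.
Variables (R : comPzRingType) (n : nat).
Implicit Types (g h : 'I_n -> R) (u v w : ext R n) (I J K : {set 'I_n}).

Fact escale_is_additive (c : R) : zmod_morphism (@escale R n c).
Proof. by move=> u v; apply/ffunP => I; rewrite !ffunE mulrBr. Qed.
HB.instance Definition _ (c : R) :=
  GRing.isZmodMorphism.Build (ext R n) (ext R n) (@escale R n c)
    (escale_is_additive c).

Fact kdiff_is_additive g : zmod_morphism (kdiff g).
Proof.
move=> u v; apply/ffunP => I; rewrite !ffunE -sumrB.
by apply: eq_bigr => l _; rewrite !ffunE mulrBr.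
Qed.
HB.instance Definition _ g :=
  GRing.isZmodMorphism.Build (ext R n) (ext R n) (kdiff g) (kdiff_is_additive g).

Fact wedge_is_additive u : zmod_morphism (wedge u).
Proof.
move=> v w; apply/ffunP => I; rewrite !ffunE -sumrB.
by apply: eq_bigr => l _; rewrite !ffunE mulrBr.
Qed.
HB.instance Definition _ u :=
  GRing.isZmodMorphism.Build (ext R n) (ext R n) (wedge u) (wedge_is_additive u).

Lemma wedgeDl u v w : wedge (u + v) w = wedge u w + wedge v w.
Proof.
apply/ffunP => I; rewrite !ffunE -big_split /=.
by apply: eq_bigr => l _; rewrite !ffunE mulrDr mulrDl.
Qed.

Lemma wedge0l w : wedge 0 w = 0.
Proof.
by apply/ffunP => I; rewrite !ffunE big1 // => J _; rewrite ffunE mulr0 mul0r.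
Qed.

Lemma wedge_suml (T : Type) (s : seq T) (P : pred T) (F : T -> ext R n) w :
  wedge (\sum_(i <- s | P i) F i) w = \sum_(i <- s | P i) wedge (F i) w.
Proof.
exact: (big_morph (fun u => wedge u w) (fun u v => wedgeDl u v w) (wedge0l w)).
Qed.

Lemma wedge_scalel c u w : wedge (escale c u) w = escale c (wedge u w).
Proof.
apply/ffunP => I; rewrite !ffunE mulr_sumr.
by apply: eq_bigr => l _; rewrite !ffunE; ring.
Qed.

Lemma wedge_scaler c u w : wedge u (escale c w) = escale c (wedge u w).
Proof.
apply/ffunP => I; rewrite !ffunE mulr_sumr.
by apply: eq_bigr => l _; rewrite !ffunE; ring.
Qed.

Lemma kdiff_scale g c u : kdiff g (escale c u) = escale c (kdiff g u).
Proof.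
apply/ffunP => I; rewrite !ffunE mulr_sumr.
by apply: eq_bigr => l _; rewrite !ffunE; ring.
Qed.

Lemma escaleA (b c : R) u : escale b (escale c u) = escale (b * c) u.
Proof. by apply/ffunP => I; rewrite !ffunE mulrA. Qed.

Lemma escale1 u : escale 1 u = u.
Proof. by apply/ffunP => I; rewrite !ffunE mul1r. Qed.

(** * Associativity and unit of the wedge product *)

Let invs I J := [set p : 'I_n * 'I_n | [&& p.1 \in I, p.2 \in J & (p.2 < p.1)%N]].

Lemma wsignUl I J K : [disjoint I & J] ->
  wsign R (I :|: J) K = wsign R I K * wsign R J K.
Proof.
move=> dIJ; rewrite /wsign -exprD -!/(invs _ _); congr (_ ^+ _).
rewrite -[RHS]subn0 -[X in (_ - X)%N](cards0 ('I_n * 'I_n)%type).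
have <- : invs I K :&: invs J K = set0.
  apply/setP => p; rewrite !inE; have := disjointFr dIJ (x := p.1).
  by case: (p.1 \in I) => [->//|_]; rewrite ?andbF.
rewrite -cardsU; congr #|pred_of_set _|; apply/setP => p; rewrite !inE.
by case: (p.1 \in I); case: (p.1 \in J); rewrite ?orbF ?orbb.
Qed.

Lemma wsignUr I J K : [disjoint J & K] ->
  wsign R I (J :|: K) = wsign R I J * wsign R I K.
Proof.
move=> dJK; rewrite /wsign -exprD -!/(invs _ _); congr (_ ^+ _).
rewrite -[RHS]subn0 -[X in (_ - X)%N](cards0 ('I_n * 'I_n)%type).
have <- : invs I J :&: invs I K = set0.
  apply/setP => p; rewrite !inE; have := disjointFr dJK (x := p.2).
  by case: (p.2 \in J) => [->//|_]; rewrite ?andbF.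
rewrite -cardsU; congr #|pred_of_set _|; apply/setP => p; rewrite !inE.
by case: (p.1 \in I); case: (p.2 \in J); case: (p.2 \in K); rewrite ?orbF ?orbb.
Qed.

Lemma wsign0l I : wsign R set0 I = 1.
Proof.
rewrite /wsign (_ : [set _ | _] = set0) ?cards0 //.
by apply/setP => p; rewrite !inE.
Qed.

Lemma wsign0r I : wsign R I set0 = 1.
Proof.
rewrite /wsign (_ : [set _ | _] = set0) ?cards0 //.
by apply/setP => p; rewrite !inE andbF.
Qed.

Lemma wsign1l i I : wsign R [set i] I = (-1) ^+ below_count I i.
Proof.
rewrite /wsign /below_count; congr (_ ^+ _).
rewrite -[RHS](card_imset _ (f := pair i)); last by move=> x y [].
congr #|pred_of_set _|; apply/setP => -[x y]; rewrite !inE /=.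
apply/idP/imsetP => [/and3P[/eqP -> yI yi]|[z + [-> ->]]].
  by exists y; rewrite ?inE ?yI.
by rewrite inE eqxx.
Qed.

(** Both sides are sums over chains of sets I, J, K, each inside the next, with factors at I, J
    minus I and K minus J. The signs agree because [wsign] is multiplicative over disjoint unions in
    either argument. *)
Lemma wedgeA u v w : wedge u (wedge v w) = wedge (wedge u v) w.
Proof.
apply/ffunP => K; rewrite !ffunE.
pose F I J := wsign R I (J :\: I) * wsign R J (K :\: J) *
  u I * v (J :\: I) * w (K :\: J).
transitivity (\sum_(I : {set 'I_n}) \sum_(J : {set 'I_n} | (I \subset J) && (J \subset K)) F I J).
  rewrite big_mkcond /=; apply: eq_bigr => I _; case: ifPn => IK; last first.
    rewrite big_pred0 // => J; apply: contraNF IK => /andP[].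
    exact: subset_trans.
  rewrite ffunE mulr_sumr.
  (* The inner sum on the left runs over J minus I instead of J. *)
  rewrite [RHS](reindex_onto (fun J => I :|: J) (fun J => J :\: I)) /=; last first.
    move=> J /andP[IJ _]; rewrite setDE setUIr setUCr setIT.
    by apply/setUidPr.
  apply: eq_big => J.
    rewrite subsetUl subUset IK /= setDUl setDv set0U.
    apply/subsetP/andP => [sJ|[/subsetP JK /eqP <-]].
      split; first by apply/subsetP => x /sJ; rewrite inE => /andP[].
      apply/eqP/setDidPl; rewrite disjoint_subset; apply/subsetP => x /sJ.
      by rewrite !inE => /andP[].
    by move=> x; rewrite !inE => /andP[-> /JK].
  move=> sJ; have dJ : [disjoint J & I].
    rewrite disjoint_subset; apply: subset_trans sJ _.
    by apply/subsetP => x; rewrite !inE => /andP[].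
  have JE : (I :|: J) :\: I = J by rewrite setDUl setDv set0U; apply/setDidPl.
  have KE : K :\: I = J :|: (K :\: (I :|: J)).
    apply/setP => x; rewrite !inE; have := subsetP sJ x; rewrite inE.
    by case: (x \in J) => /=; [move=> -> // | rewrite orbF].
  rewrite /F JE setDDl [X in wsign R I X]KE wsignUr; last first.
    by rewrite disjoint_sym disjoint_subset; apply/subsetP => x; rewrite !inE negb_or; case: (x \in J); rewrite ?andbF.
  rewrite wsignUl 1?disjoint_sym //; ring.
rewrite (exchange_big_dep (fun J : {set 'I_n} => J \subset K)) /=; last by move=> I J _ /andP[].
apply: eq_bigr => J JK; rewrite ffunE mulr_sumr mulr_suml.
apply: eq_big => [I|I IJ]; first by rewrite JK andbT.
rewrite /F; ring.
Qed.

Lemma wedge1l u : wedge (ebasis R set0) u = u.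
Proof.
apply/ffunP => K; rewrite ffunE (bigD1 set0) ?sub0set //= big1 => [|I /andP[_ /negbTE I0]].
  by rewrite wsign0l !ffunE eqxx setD0 !mul1r addr0.
by rewrite !ffunE I0 mulr0 mul0r.
Qed.

Lemma wedge1r u : wedge u (ebasis R set0) = u.
Proof.
apply/ffunP => K; rewrite ffunE (bigD1 K) //= big1 => [|I /andP[IK IneqK]].
  by rewrite setDv ffunE eqxx wsign0r mul1r mulr1 addr0.
rewrite [X in _ * X]ffunE setD_eq0; case: (boolP (K \subset I)) => [KI|_].
  by case/eqP: IneqK; apply/eqP; rewrite eqEsubset IK.
by rewrite mulr0.
Qed.

(** * Relations between exterior multiplication and contraction *)

Definition emul g u : ext R n :=
  [ffun K : {set 'I_n} => \sum_(i in K) (-1) ^+ below_count K i * g i * u (K :\ i)].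

Lemma wedge_linear g u :
  wedge (\sum_i escale (g i) (ebasis R [set i])) u = emul g u.
Proof.
rewrite wedge_suml; apply/ffunP => K; rewrite sum_ffunE ffunE [RHS]big_mkcond.
apply: eq_bigr => i _; rewrite wedge_scalel !ffunE.
case: ifPn => iK; last first.
  rewrite big1 ?mulr0 // => I IK; rewrite ffunE.
  case: eqP => [I1|_]; last by rewrite mulr0 mul0r.
  by move: IK; rewrite I1 sub1set (negbTE iK).
rewrite (bigD1 [set i]) ?sub1set //= big1 => [|I /andP[_ /negbTE I0]].
  rewrite ffunE eqxx wsign1l (below_countD1 i iK) ltnn add0n /=; ring.
by rewrite !ffunE I0 mulr0 mul0r.
Qed.

Fact emul_is_additive g : zmod_morphism (emul g).
Proof.
move=> u v; apply/ffunP => I; rewrite !ffunE -sumrB.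
by apply: eq_bigr => l _; rewrite !ffunE mulrBr.
Qed.
HB.instance Definition _ g :=
  GRing.isZmodMorphism.Build (ext R n) (ext R n) (emul g) (emul_is_additive g).

Lemma emul_scale g c u : emul g (escale c u) = escale c (emul g u).
Proof. by rewrite -!wedge_linear wedge_scaler. Qed.

(** Two multiplications, or two contractions, compose to a sum of g_i h_j G_ij with G alternating.
    This yields anticommutation and vanishing squares at once. *)
Lemma sum_alternating2 (G : 'I_n -> 'I_n -> R) :
    (forall i j, G i j = - G j i) -> (forall i, G i i = 0) ->
    (forall g h, \sum_i \sum_j g i * h j * G i j = - \sum_i \sum_j h i * g j * G i j)
    /\ (forall g, \sum_i \sum_j g i * g j * G i j = 0).
Proof.
move=> GN G0; split=> [g h|g].
  rewrite exchange_big /= -sumrN; apply: eq_bigr => i _.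
  by rewrite -sumrN; apply: eq_bigr => j _; rewrite GN; ring.
apply: sum_alternating => [i j|i]; last by rewrite G0 mulr0.
by rewrite GN; ring.
Qed.

Let emul2 u K i j : R := if (i \in K) && (j \in K :\ i)
  then (-1) ^+ (below_count K i + below_count (K :\ i) j) * u (K :\ i :\ j) else 0.

Lemma emul_emulE g h u K :
  emul g (emul h u) K = \sum_i \sum_j g i * h j * emul2 u K i j.
Proof.
rewrite ffunE big_mkcond /=; apply: eq_bigr => i _; rewrite /emul2.
case: (i \in K) => /=; last by rewrite big1 // => j _; rewrite mulr0.
rewrite ffunE mulr_sumr big_mkcond /=; apply: eq_bigr => j _.
by case: ifP => _; [rewrite exprD; ring | rewrite mulr0].
Qed.

(** Removing two indices in the other order changes exactly one of the two counts, by one: that of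
    the larger index. *)
Lemma emul2_alternating u K :
  (forall i j, emul2 u K i j = - emul2 u K j i) /\ (forall i, emul2 u K i i = 0).
Proof.
split=> [i j|i]; last by rewrite /emul2 setD11 andbF.
rewrite /emul2 !inE eq_sym andbCA [in RHS]andbCA.
case: eqVneq => [|ij] /=; first by rewrite oppr0.
rewrite [in RHS]andbC; case: andP => [[iK jK]|_]; last by rewrite oppr0.
rewrite (below_countD1 i jK) (below_countD1 j iK).
have -> : K :\ j :\ i = K :\ i :\ j by rewrite !setDDl setUC.
move: ij; rewrite -val_eqE /= neq_ltn.
by case: ltngtP => //= _ _; rewrite !exprD ?expr0 ?expr1; ring.
Qed.

Lemma emulC g h u : emul g (emul h u) = - emul h (emul g u).
Proof.
apply/ffunP => K; rewrite [RHS]ffunE !emul_emulE.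
by have [N Z] := emul2_alternating u K; apply: (sum_alternating2 N Z).1.
Qed.

Lemma emulxx g u : emul g (emul g u) = 0.
Proof.
apply/ffunP => K; rewrite [RHS]ffunE emul_emulE.
by have [N Z] := emul2_alternating u K; apply: (sum_alternating2 N Z).2.
Qed.

Let kdiff2 u I l m : R := if (l \notin I) && (m \notin l |: I)
  then (-1) ^+ (below_count I l + below_count (l |: I) m) * u (m |: (l |: I)) else 0.

Lemma kdiff_kdiffE g h u I :
  kdiff g (kdiff h u) I = \sum_l \sum_m g l * h m * kdiff2 u I l m.
Proof.
rewrite ffunE big_mkcond /=; apply: eq_bigr => l _; rewrite /kdiff2.
case: (l \notin I) => /=; last by rewrite big1 // => m _; rewrite mulr0.
rewrite ffunE mulr_sumr big_mkcond /=; apply: eq_bigr => m _.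
by case: ifP => _; [rewrite exprD; ring | rewrite mulr0].
Qed.

Lemma kdiff2_alternating u I :
  (forall l m, kdiff2 u I l m = - kdiff2 u I m l) /\ (forall l, kdiff2 u I l l = 0).
Proof.
split=> [l m|l]; last by rewrite /kdiff2 setU11 andbF.
rewrite /kdiff2 !inE !negb_or eq_sym andbCA [in RHS]andbCA.
case: eqVneq => [|lm] /=; first by rewrite oppr0.
rewrite [in RHS]andbC; case: andP => [[lI mI]|_]; last by rewrite oppr0.
rewrite !below_countU1 // setUCA.
move: lm; rewrite -val_eqE /= neq_ltn.
by case: ltngtP => //= _ _; rewrite !exprD ?expr0 ?expr1; ring.
Qed.

Lemma kdiffC g h u : kdiff g (kdiff h u) = - kdiff h (kdiff g u).
Proof.
apply/ffunP => I; rewrite [RHS]ffunE !kdiff_kdiffE.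
by have [N Z] := kdiff2_alternating u I; apply: (sum_alternating2 N Z).1.
Qed.

Lemma kdiffxx g u : kdiff g (kdiff g u) = 0.
Proof.
apply/ffunP => I; rewrite [RHS]ffunE kdiff_kdiffE.
by have [N Z] := kdiff2_alternating u I; apply: (sum_alternating2 N Z).2.
Qed.

(** The derivation property of contraction against a linear form. In the double sum over [l] and [i]
    the off-diagonal terms of the two composites cancel, and on the diagonal exactly one composite
    contributes. *)
Lemma kdiff_emul g h u :
  kdiff h (emul g u) = escale (\sum_l h l * g l) u - emul g (kdiff h u).
Proof.
apply/eqP; rewrite eq_sym subr_eq eq_sym; apply/eqP/ffunP => K.
rewrite !ffunE mulr_suml.
transitivity (\sum_l \sum_i (if l == i then h l * g l * u K else 0)); last first.
  by apply: eq_bigr => l _; rewrite -big_mkcond /= (big_pred1 l).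
rewrite [X in _ + X]big_mkcond [X in X + _]big_mkcond /=.
pose E l i := if i \in K then (-1) ^+ below_count K i * g i *
  (if l \notin K :\ i then (-1) ^+ below_count (K :\ i) l * h l * u (l |: K :\ i)
   else 0) else 0.
rewrite [X in _ + X](_ : _ = \sum_l \sum_i E l i); last first.
  rewrite exchange_big /=; apply: eq_bigr => i _; rewrite /E.
  case: ifP => _; last by rewrite big1.
  by rewrite ffunE mulr_sumr big_mkcond /=; apply: eq_bigr => l _; case: ifP; rewrite ?mulr0.
rewrite -big_split; apply: eq_bigr => l _ /=; rewrite /E.
(* For [l] in [K] only multiplication after contraction contributes, at [i = l]. For [l] outside [K]
   the term [i = l] comes from the other composite and the remaining ones cancel in pairs. *)
case: (boolP (l \in K)) => lK /=.
  rewrite add0r; apply: eq_bigr => i _; rewrite !inE lK andbT eq_sym.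
  case: eqVneq => [?|_]; last by rewrite mulr0 if_same.
  subst i.
  rewrite lK (below_countD1 l lK) ltnn add0n setD1K //.
  by rewrite -!(signr_odd _ (below_count (K :\ l) l)); case: odd; rewrite /= ?expr0 ?expr1; ring.
rewrite ffunE mulr_sumr big_mkcond -big_split /=.
apply: eq_bigr => i _; rewrite !inE eq_sym.
case: eqVneq => [?|li] /=.
  subst i; rewrite (negbTE lK) addr0 setU1K // below_countU1 // ltnn add0n.
  by rewrite -!(signr_odd _ (below_count K l)); case: odd; rewrite /= ?expr0 ?expr1; ring.
case: ifP => iK /=; last by rewrite addr0.
rewrite lK below_countU1 // (below_countD1 l iK).
have -> : (l |: K) :\ i = l |: K :\ i.
  apply/setP => x; rewrite !inE; case: (eqVneq x l) => [->|//].
  by rewrite /= andbT; exact: li.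
move: li; rewrite -val_eqE /= neq_ltn.
by case: ltngtP => //= _ _; rewrite !exprD ?expr0 ?expr1; ring.
Qed.

(** The l-th coordinate form: [kdiff (dirac l)] is contraction by the dual of e_l, the l-th piece of
    any Koszul differential. *)
Definition dirac l : 'I_n -> R := fun m => (m == l)%:R.

Lemma kdiff_diracE l u I :
  kdiff (dirac l) u I =
    if l \in I then 0 else (-1) ^+ below_count I l * u (l |: I).
Proof.
rewrite ffunE /dirac; case: ifPn => lI.
  rewrite big1 // => m; case: eqVneq => [->|]; first by rewrite lI.
  by rewrite mulr0 mul0r.
rewrite (bigD1 l) //= eqxx mulr1 big1 ?addr0 // => m /andP[_ /negbTE ->].
by rewrite mulr0 mul0r.
Qed.

Lemma kdiff_dirac_emul g l u :
  kdiff (dirac l) (emul g u) = escale (g l) u - emul g (kdiff (dirac l) u).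
Proof.
rewrite kdiff_emul; congr (escale _ _ - _).
rewrite (bigD1 l) //= /dirac eqxx mul1r big1 ?addr0 // => m /negbTE ->.
by rewrite mul0r.
Qed.

End Operators.

(** * Total cycles *)

Section DisguisedResidualIntersection.
Variables (R : comPzRingType) (r s : nat) (Phi : 'M[R]_(r, s)).
Implicit Types (I sigma tau A : {set 'I_r}) (J : {set 'I_s}) (u v : ext R r).

(** * Products of the zeta_j, and the sign twist *)

Definition zmul (j : 'I_s) : {additive ext R r -> ext R r} := emul (Phi^~ j).

Lemma wedge_zeta j u : wedge (zeta Phi j) u = zmul j u.
Proof. exact: wedge_linear. Qed.

Definition zprod J u : ext R r := oprod zmul J u.

Fact zprod_is_additive J : zmod_morphism (zprod J).
Proof. exact: oprod_is_additive. Qed.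
HB.instance Definition _ J :=
  GRing.isZmodMorphism.Build (ext R r) (ext R r) (zprod J) (zprod_is_additive J).

Lemma zprod_scale J c u : zprod J (escale c u) = escale c (zprod J u).
Proof. by rewrite /zprod -(oprod_morph (h := escale c)) // => l v; rewrite /= emul_scale. Qed.

Lemma wedge_zprod J u v : wedge (zprod J u) v = zprod J (wedge u v).
Proof.
rewrite /zprod -(oprod_morph (h := fun w => wedge w v)) // => l w.
by rewrite -!wedge_zeta wedgeA.
Qed.

Lemma zmul_zprod j J u :
  zmul j (zprod J u) =
    if j \in J then 0 else sgn (below_count J j) (zprod (j |: J) u).
Proof. by apply: oprod_act => *; [apply: emulC | apply: emulxx]. Qed.

(** Instance of the Leibniz rule: contracting zeta_j by the dual of e_l gives the scalar
    [Phi l j]. *)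
Lemma kdiff_zprod l J u :
  kdiff (dirac R l) (zprod J u) = sgn #|J| (zprod J (kdiff (dirac R l) u))
    + \sum_(j in J) sgn (below_count J j) (escale (Phi l j) (zprod (J :\ j) u)).
Proof.
apply: (oprod_derivation (C := kdiff (dirac R l)) (K := fun j => escale (Phi l j))).
  by move=> j v; apply: kdiff_dirac_emul.
by move=> j k v; apply: emul_scale.
Qed.

(** The sign of moving [k] factors of degree one past e_I. *)
Definition twist k u : ext R r := [ffun I : {set 'I_r} => (-1) ^+ (k * #|I|) * u I].

Fact twist_is_additive k : zmod_morphism (twist k).
Proof. by move=> u v; apply/ffunP => I; rewrite !ffunE mulrBr. Qed.
HB.instance Definition _ k :=
  GRing.isZmodMorphism.Build (ext R r) (ext R r) (twist k) (twist_is_additive k).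

Lemma twist_scale k c u : twist k (escale c u) = escale c (twist k u).
Proof. by apply/ffunP => I; rewrite !ffunE; ring. Qed.

Lemma twist1 k u : twist k (twist 1 u) = twist k.+1 u.
Proof. by apply/ffunP => I; rewrite !ffunE mulrA -exprD -mulnDl addn1. Qed.

Lemma twistK k : involutive (twist k).
Proof.
by move=> u; apply/ffunP => I; rewrite !ffunE mulrA -exprMn mulrNN mul1r expr1n mul1r.
Qed.

Lemma twist_kdiff (g : 'I_r -> R) k u : twist k (kdiff g u) = sgn k (kdiff g (twist k u)).
Proof.
apply/ffunP => I; rewrite sgn_ffunE sgnE !ffunE !mulr_sumr; apply: eq_bigr => l lI.
rewrite !ffunE cardsU1 lI mulnDr muln1 exprD -(signr_odd _ k).
by case: odd; rewrite ?expr0 ?expr1; ring.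
Qed.

Lemma twist_homog k d u : homog d u -> twist k u = escale ((-1) ^+ (k * d)) u.
Proof.
move=> hu; apply/ffunP => I; rewrite !ffunE.
by case: (eqVneq (u I) 0) => [->|/hu ->]; rewrite ?mulr0.
Qed.

(** * The chain map to the Koszul complex, and the operators d_l *)

Local Notation zext := {ffun {set 'I_s} -> ext R r}.
Implicit Type w : zext.

(* The chain map K(T) (x) K(gamma) -> K(T), eps_J |-> zeta_J; the twist
   (-1)^(#|I| #|J|) is the cost of moving eps_J to the left of e_I. *)
Definition to_koszul (w : zext) : ext R r := \sum_J zprod J (twist #|J| (w J)).

Fact to_koszul_is_additive : zmod_morphism to_koszul.
Proof.
by move=> v w; rewrite /to_koszul -sumrB; apply: eq_bigr => J _; rewrite !ffunE !raddfB.
Qed.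
HB.instance Definition _ :=
  GRing.isZmodMorphism.Build zext (ext R r) to_koszul to_koszul_is_additive.

(* The differential of D is [sum_l T_l (dcoef l)]. *)
Definition dcoef l (w : zext) : zext :=
  [ffun J : {set 'I_s} => [ffun I : {set 'I_r} => kdiff (dirac R l) (w J) I
    + (-1) ^+ #|I| * kdiff (Phi l) [ffun J' : {set 'I_s} => w J' I] J]].

Lemma dcoef_ffunE l w J I : dcoef l w J I = kdiff (dirac R l) (w J) I
  + (-1) ^+ #|I| * kdiff (Phi l) [ffun J' : {set 'I_s} => w J' I] J.
Proof. by rewrite /dcoef [X in fun_of_fin X I = _]ffunE [LHS]ffunE. Qed.

Fact dcoef_is_additive l : zmod_morphism (dcoef l).
Proof.
move=> v w; apply/ffunP => J; apply/ffunP => I.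
have subE (T : finType) (V : zmodType) (x y : {ffun T -> V}) t :
  (x - y) t = x t - y t by rewrite !ffunE.
rewrite !subE !dcoef_ffunE subE.
have -> : [ffun J' : {set 'I_s} => (v - w) J' I] =
    [ffun J' : {set 'I_s} => v J' I] - [ffun J' : {set 'I_s} => w J' I].
  by apply/ffunP => J'; rewrite !ffunE.
by rewrite !raddfB /= !subE; ring.
Qed.
HB.instance Definition _ l :=
  GRing.isZmodMorphism.Build zext zext (dcoef l) (dcoef_is_additive l).

Lemma dcoefE l w J :
  dcoef l w J = kdiff (dirac R l) (w J)
    + \sum_(j | j \notin J)
        sgn (below_count J j) (escale (Phi l j) (twist 1 (w (j |: J)))).
Proof.
apply/ffunP => I; rewrite dcoef_ffunE [RHS]ffunE; congr (_ + _).
rewrite sum_ffunE ffunE mulr_sumr; apply: eq_bigr => j _.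
by rewrite sgn_ffunE sgnE !ffunE mul1n; ring.
Qed.

(** The chain map property for each variable T_l separately: the contraction of eps_j, with
    coefficient [Phi l j], matches that of zeta_j. *)
Lemma to_koszul_dcoef l w : to_koszul (dcoef l w) = kdiff (dirac R l) (to_koszul w).
Proof.
rewrite /to_koszul raddf_sum /=.
under eq_bigr => J _ do rewrite dcoefE raddfD raddfD raddf_sum raddf_sum /= twist_kdiff raddf_sgn /=.
under [RHS]eq_bigr => J _ do rewrite kdiff_zprod.
rewrite !big_split /=; congr (_ + _).
rewrite (exchange_big_dep predT) // [RHS](exchange_big_dep predT) //=.
apply: eq_bigr => j _.
(* A pair of [J] and [j] outside it on the left corresponds to [j |: J] with its element [j] on the
   right. *)
rewrite [RHS](reindex_onto (fun J => j |: J) (fun J => J :\ j)) /=; last first.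
  by move=> J; apply: setD1K.
apply: eq_big => [J|J jJ].
  rewrite setU11 /=; apply/idP/eqP => [jJ|<-]; first by rewrite setU1K.
  by rewrite setD11.
rewrite below_countU1 // ltnn add0n setU1K // cardsU1 jJ add1n.
by rewrite !raddf_sgn /= twist_scale twist1 zprod_scale.
Qed.

(** * Anticommutation of the d_l, and what they preserve *)

Let cross l m (w : zext) J I : R := if l \in I then 0 else
  (-1) ^+ (#|I| + below_count I l) *
    kdiff (Phi m) [ffun J' : {set 'I_s} => w J' (l |: I)] J.

(** The composite splits into two contractions of the e, two of the eps, and mixed terms.
    Contracting e_l changes the parity of [#|I|], so the mixed terms have opposite signs, and all
    three parts alternate in [l] and [m]. *)
Lemma dcoef_dcoefE l m w J I :
  dcoef l (dcoef m w) J I =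
    kdiff (dirac R l) (kdiff (dirac R m) (w J)) I
    + kdiff (Phi l) (kdiff (Phi m) [ffun J' : {set 'I_s} => w J' I]) J
    + (cross m l w J I - cross l m w J I).
Proof.
rewrite dcoef_ffunE; set P := fun I' => kdiff (Phi m) [ffun J' : {set 'I_s} => w J' I'].
have -> : dcoef m w J = kdiff (dirac R m) (w J)
    + [ffun I' : {set 'I_r} => (-1) ^+ #|I'| * P I' J].
  by apply/ffunP => I'; rewrite dcoef_ffunE [RHS]ffunE [X in _ = _ + X]ffunE.
have -> : [ffun J' : {set 'I_s} => dcoef m w J' I] =
   [ffun J' : {set 'I_s} => kdiff (dirac R m) (w J') I]
   + escale ((-1) ^+ #|I|) (P I).
  apply/ffunP => J'; rewrite ffunE dcoef_ffunE [RHS]ffunE.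
  by rewrite [X in _ = X + _]ffunE [X in _ = _ + X]ffunE.
rewrite !raddfD /= [X in X + _]ffunE [X in _ + _ * X]ffunE kdiff_scale.
rewrite [X in _ + _ * (_ + X)]ffunE mulrDr; set D := kdiff _ (kdiff _ (w J)) I.
rewrite kdiff_diracE ffunE.
have -> : (-1) ^+ #|I| * kdiff (Phi l)
    [ffun J' : {set 'I_s} => kdiff (dirac R m) (w J') I] J = cross m l w J I.
  rewrite /cross; case: ifP => mI.
    rewrite (_ : [ffun J' => _] = 0) ?raddf0 ?ffunE ?mulr0 //.
    by apply/ffunP => J'; rewrite ffunE kdiff_diracE mI ffunE.
  rewrite (_ : [ffun J' => _] = escale ((-1) ^+ below_count I m)
      [ffun J' : {set 'I_s} => w J' (m |: I)]); last first.
    by apply/ffunP => J'; rewrite ffunE kdiff_diracE mI !ffunE.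
  by rewrite kdiff_scale ffunE exprD mulrA.
rewrite -/(P I) (mulrA ((-1) ^+ #|I|) ((-1) ^+ #|I|)) -expr2 sqrr_sign mul1r.
rewrite [cross l m w J I]/cross -/(P _); case: ifPn => lI; first by ring.
by rewrite cardsU1 lI exprS exprD; ring.
Qed.

Lemma dcoefC l m w : dcoef l (dcoef m w) = - dcoef m (dcoef l w).
Proof.
apply/ffunP => J; apply/ffunP => I.
rewrite [RHS](_ : _ = - dcoef m (dcoef l w) J I); last by rewrite [X in fun_of_fin X I]ffunE [LHS]ffunE.
rewrite !dcoef_dcoefE.
by rewrite (kdiffC (dirac R l)) (kdiffC (Phi l)) [X in X + _ + _]ffunE [X in _ + X + _]ffunE; ring.
Qed.

Lemma dcoefxx l w : dcoef l (dcoef l w) = 0.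
Proof.
by apply/ffunP => J; apply/ffunP => I; rewrite dcoef_dcoefE !kdiffxx !ffunE subrr !addr0.
Qed.

(** Cycles are stable under contraction because the Koszul differential of [f] anticommutes with it,
    and under [twist 1] for the same reason up to sign. *)
Lemma kdiff_dcoef (f : 'I_r -> R) l w :
  (forall J, kdiff f (w J) = 0) -> forall J, kdiff f (dcoef l w J) = 0.
Proof.
move=> fw J; rewrite dcoefE raddfD /= kdiffC fw raddf0 oppr0 add0r raddf_sum /=.
rewrite big1 // => j _; rewrite raddf_sgn /= kdiff_scale.
have := twist_kdiff f 1 (w (j |: J)); rewrite fw raddf0 /= => /eqP.
by rewrite eq_sym oppr_eq0 => /eqP ->; rewrite !raddf0 sgn0.
Qed.

(** Total degree r - d in the e and eps together, stated additively to avoid truncated subtraction;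
    each d_l raises [d] by one. *)
Definition codegree (d : nat) (w : zext) : Prop :=
  forall I J, w J I != 0 -> (#|I| + #|J| + d)%N = r.

Lemma codegree_dcoef d l w : codegree d w -> codegree d.+1 (dcoef l w).
Proof.
move=> dw I J; apply: contra_neq_eq => IJ; rewrite dcoef_ffunE kdiff_diracE.
have w0 I' J' : (#|I'| + #|J'| + d)%N = (#|I| + #|J| + d.+1)%N -> w J' I' = 0.
  by move=> E; apply: contra_neq_eq IJ => /dw; rewrite E.
rewrite [X in _ + _ * X]ffunE big1 ?mulr0 ?addr0 => [|j jJ].
  case: ifPn => // lI; rewrite w0 ?mulr0 //.
  by rewrite cardsU1 lI !addSnnS.
by rewrite ffunE w0 ?mulr0 // cardsU1 jJ add1n -!addnA addSnnS !addnA.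
Qed.

Definition deriv (A : {set 'I_r}) (w : zext) : zext :=
  oprod (fun l => dcoef l : {additive zext -> zext}) A w.

Lemma dcoef_deriv l A w :
  dcoef l (deriv A w) =
    if l \in A then 0 else sgn (below_count A l) (deriv (l |: A) w).
Proof. by apply: oprod_act => *; [apply: dcoefC | apply: dcoefxx]. Qed.

Lemma codegree_deriv A w : codegree 0 w -> codegree #|A| (deriv A w).
Proof.
rewrite -[#|A|]addn0; apply: (oprod_ind (P := codegree)) => i l v.
exact: codegree_dcoef.
Qed.

Lemma kdiff_deriv (f : 'I_r -> R) A w :
  (forall J, kdiff f (w J) = 0) -> forall J, kdiff f (deriv A w J) = 0.
Proof.
move=> fw; apply: (oprod_closed (P := fun v : zext => forall J, kdiff f (v J) = 0)) fw.
exact: kdiff_dcoef.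
Qed.

(** * Coefficients of a cochain at a fixed Laurent monomial *)

Definition slice (x : dcx R r s) sigma (a : expo r) : zext :=
  [ffun J : {set 'I_s} => [ffun I : {set 'I_r} => x sigma I J a]].

Lemma sliceE (x : dcx R r s) sigma a J I : slice x sigma a J I = x sigma I J a.
Proof. by rewrite /slice [X in fun_of_fin X I = _]ffunE [LHS]ffunE. Qed.

Lemma sum_zextE (T : Type) (t : seq T) (P : pred T) (F : T -> zext) J I :
  (\sum_(i <- t | P i) F i) J I = \sum_(i <- t | P i) F i J I.
Proof. by rewrite !sum_ffunE. Qed.

Lemma Ddiff_slice (x : dcx R r s) sigma I J a :
  Ddiff Phi x sigma I J a = (\sum_l dcoef l (slice x sigma (shift a l))) J I.
Proof.
rewrite sum_zextE; under [RHS]eq_bigr => l _ do rewrite dcoef_ffunE kdiff_diracE sliceE.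
rewrite big_split /Ddiff big_mkcond /=; congr (_ + _).
  by apply: eq_bigr => l _; case: (l \in I).
rewrite -mulr_sumr; congr (_ * _).
under [RHS]eq_bigr => l _ do rewrite ffunE.
rewrite exchange_big /=; apply: eq_bigr => j _; rewrite mulr_sumr.
by apply: eq_bigr => l _; rewrite ffunE sliceE mulrA.
Qed.

Lemma cech_slice (x : dcx R r s) tau I J a :
  cech x tau I J a =
    (\sum_(l in tau) sgn (below_count tau l) (slice x (tau :\ l) a)) J I.
Proof.
rewrite sum_zextE; apply: eq_bigr => l _.
by rewrite !sgn_ffunE sgnE sliceE.
Qed.

(* The exponent of the product of the T_l^-1, l in sigma. *)
Definition expoN (sigma : {set 'I_r}) : expo r :=
  [ffun l => - ((l \in sigma) : nat)%:Z].

Lemma expoN0 : expoN set0 = expo0 r.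
Proof. by apply/ffunP => l; rewrite !ffunE inE oppr0. Qed.

Lemma shift_expoN sigma l : l \notin sigma -> shift (expoN sigma) l = expoN (l |: sigma).
Proof.
move=> lN; apply/ffunP => m; rewrite !ffunE !inE.
by case: eqVneq => [->|_]; rewrite ?(negbTE lN) ?oppr0 ?sub0r ?subr0.
Qed.

Lemma shift_expoN_eq tau l a :
  l \in tau -> (shift a l == expoN tau) = (a == expoN (tau :\ l)).
Proof.
move=> lt; rewrite -{1}(setD1K lt) -shift_expoN ?setD11 //.
apply/eqP/eqP => [E|-> //]; apply/ffunP => m.
by move/ffunP: E => /(_ m); rewrite !ffunE => /addIr.
Qed.

Lemma sum_expoN sigma : \sum_(l < r) expoN sigma l = - (#|sigma|)%:Z.
Proof.
under eq_bigr => l _ do rewrite ffunE.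
rewrite sumrN -sum1_card (big_morph Posz PoszD (erefl _)) [in RHS]big_mkcond /=.
by congr (- _); apply: eq_bigr => l _; case: (l \in sigma).
Qed.

(** * The diagonal coefficients of a total cycle all agree *)

Section TotalCycle.
Variable x : dcx R r s.
Hypotheses (xW : well_placed x)
  (xC : forall tau I J a, Ddiff Phi x tau I J a = cech x tau I J a).

Lemma slice0 sigma (a : expo r) l : l \notin sigma -> (a l < 0)%R -> slice x sigma a = 0.
Proof.
move=> lN al; apply/ffunP => J; apply/ffunP => I; rewrite sliceE !ffunE.
by apply: contraTeq al => /xW[_ _ /(_ _ lN)]; rewrite Order.TotalTheory.leNgt.
Qed.

Definition diag_coef sigma : R := to_koszul (slice x sigma (expoN sigma)) sigma.

(** The cycle condition in the Čech component [tau] at T^(-1_sigma), mapped to the Koszul complex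
    and read at e_sigma: one term survives on each side, with the same sign. *)
Lemma diag_coefU1 sigma l : l \notin sigma -> diag_coef (l |: sigma) = diag_coef sigma.
Proof.
move=> lN; set tau := l |: sigma; set a := expoN sigma.
have E : \sum_m dcoef m (slice x tau (shift a m)) =
    \sum_(m in tau) sgn (below_count tau m) (slice x (tau :\ m) a).
  apply/ffunP => J; apply/ffunP => I.
  by rewrite -Ddiff_slice -cech_slice xC.
move/(congr1 (fun w => to_koszul w sigma)): E.
rewrite !raddf_sum /= !sum_ffunE.
(* For [m] in [sigma] a contraction by [m] has no coefficient at e_sigma. For [m] outside [tau] the
   shifted exponent is -1 at [m], where T_m is not inverted. *)
rewrite (bigD1 l) //= big1 ?addr0 => [|m ml]; last first.
  case: (boolP (m \in sigma)) => mS.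
    by rewrite to_koszul_dcoef kdiff_diracE mS.
  have -> : slice x tau (shift a m) = 0; last by rewrite !raddf0 ffunE.
  apply: (slice0 (l := m)); first by rewrite !inE negb_or ml.
  by rewrite !ffunE eqxx (negbTE mS).
(* For [m] in [sigma] the exponent at [m] is -1, but T_m is not inverted in the component
   [tau :\ m]. *)
rewrite (bigD1 l) ?setU11 //= big1 ?addr0 => [|m /andP[mT ml]]; last first.
  have mS : m \in sigma by move: mT; rewrite !inE (negbTE ml).
  have -> : slice x (tau :\ m) a = 0; last by rewrite sgn0 raddf0 ffunE.
  by apply: (slice0 (l := m)); rewrite ?setD11 // ffunE mS.
rewrite to_koszul_dcoef kdiff_diracE (negbTE lN) shift_expoN // setU1K //.
rewrite below_countU1 // ltnn add0n raddf_sgn sgn_ffunE sgnE.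
by move/(congr1 ( *%R ((-1) ^+ below_count sigma l))); rewrite !mulrA -expr2 sqrr_sign !mul1r.
Qed.

Lemma diag_coef_setT : diag_coef setT = x set0 set0 set0 (expo0 r).
Proof.
transitivity (diag_coef set0).
  suff H (t : seq 'I_r) : diag_coef [set l in t] = diag_coef set0.
    by rewrite -(H (enum 'I_r)); congr diag_coef; apply/setP => l; rewrite !inE mem_enum.
  elim: t => [|l t IH]; first by congr diag_coef; apply/setP => l; rewrite !inE.
  rewrite set_cons; case: (boolP (l \in [set m in t])) => lt.
    by rewrite -IH; congr diag_coef; apply/setUidPr; rewrite sub1set.
  by rewrite diag_coefU1.
rewrite /diag_coef /to_koszul sum_ffunE (bigD1 set0) //= big1 ?addr0 => [|J J0].
  by rewrite expoN0 /zprod oprod0 cards0 ffunE mul0n expr0 mul1r sliceE.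
(* In Čech degree 0 total index 0 forces [I] and [J] to be empty. *)
have -> : slice x set0 (expoN set0) J = 0; last by rewrite !raddf0 ffunE.
apply/ffunP => I; rewrite sliceE ffunE.
apply: contraNeq J0 => /xW[+ _ _]; rewrite cards0 => /esym/eqP.
by rewrite addn_eq0 => /andP[_]; rewrite cards_eq0.
Qed.

End TotalCycle.

(** * Linear generators of Gamma *)

Lemma homog_zprod J d u : homog d u -> homog (#|J| + d)%N (zprod J u).
Proof.
apply: (oprod_ind (P := @homog R r)) => k j v hv K.
apply: contra_neq_eq => Kk; rewrite ffunE big1 // => i iK.
suff -> : v (K :\ i) = 0 by rewrite mulr0.
apply: contra_neq_eq Kk => /hv <-.
by rewrite (cardsD1 i K) iK.
Qed.

Lemma homog_ebasis I : homog #|I| (ebasis R I).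
Proof. by move=> K; rewrite ffunE; case: (eqVneq K I) => [->|_] //=; rewrite eqxx. Qed.

Definition zetaJ J : ext R r := zprod J (ebasis R set0).

Lemma wedge_zetaJ J u : wedge (zetaJ J) u = zprod J u.
Proof. by rewrite wedge_zprod wedge1l. Qed.

Lemma Gamma_zetaJ J : Gamma Phi #|J| (zetaJ J).
Proof.
split; last first.
  by rewrite -[#|J|]addn0 -(cards0 'I_r); apply: homog_zprod; apply: homog_ebasis.
apply: oprod_closed => [j v hv|]; last exact: sa_one.
 rewrite -wedge_zeta; apply: sa_mul => //; apply: sa_gen.
by exists j.
Qed.

(** The span of the ordered products is closed under left multiplication by each zeta_j, which sends
    [zetaJ J] to zero or to a signed ordered product. Closure under all products follows by
    iteration. *)
Lemma subalg_zetaJ u :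
  in_subalg (fun v => exists j, v = zeta Phi j) u ->
  exists c : {set 'I_s} -> R, u = \sum_J escale (c J) (zetaJ J).
Proof.
pose lin v := exists c : {set 'I_s} -> R, v = \sum_J escale (c J) (zetaJ J).
have linD v1 v2 : lin v1 -> lin v2 -> lin (v1 + v2).
  move=> [b ->] [c ->]; exists (fun J => b J + c J); rewrite -big_split /=.
  by apply: eq_bigr => J _; apply/ffunP => I; rewrite !ffunE mulrDl.
have linZ c v : lin v -> lin (escale c v).
  move=> [b ->]; exists (fun J => c * b J); rewrite raddf_sum /=.
  by apply: eq_bigr => J _; rewrite escaleA.
have lin0 : lin 0.
  by exists (fun=> 0); rewrite big1 // => J _; apply/ffunP => I; rewrite !ffunE mul0r.
have linJ J : lin (zetaJ J).
  exists (fun K => (K == J)%:R); rewrite (bigD1 J) //= eqxx escale1 big1 ?addr0 //.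
  by move=> K /negbTE ->; apply/ffunP => I; rewrite !ffunE mul0r.
have lin_sum (P : pred {set 'I_s}) F : (forall J, P J -> lin (F J)) -> lin (\sum_(J | P J) F J).
  by move=> linF; apply: big_ind.
have linN k v : lin v -> lin (sgn k v).
  move=> lv; have -> : sgn k v = escale ((-1) ^+ k) v.
    by apply/ffunP => I; rewrite sgn_ffunE sgnE ffunE.
  exact: linZ.
have lin_zmul j v : lin v -> lin (zmul j v).
  move=> [c ->]; rewrite raddf_sum; apply: lin_sum => J _ /=.
  rewrite emul_scale -[emul _ _]/(zmul j _) zmul_zprod.
  by apply: linZ; case: ifP => // _; apply: linN; apply: linJ.
have lin_mul J v : lin v -> lin (wedge (zetaJ J) v).
  move=> lv; rewrite wedge_zetaJ.
  exact: oprod_closed.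
elim=> {u} [u [j ->]||u v _ + _|c u _|u v _ [b ->] _ lv].
- rewrite -(wedge1r (zeta Phi j)) wedge_zeta; apply: lin_zmul.
  by have := linJ set0; rewrite /zetaJ /zprod oprod0.
- by have := linJ set0; rewrite /zetaJ /zprod oprod0.
- exact: linD.
- exact: linZ.
- rewrite wedge_suml; apply: lin_sum => J _; rewrite wedge_scalel.
  by apply: linZ; apply: lin_mul.
Qed.

(* This sign turns the one of [dcoef_deriv] into the Cech sign, since
   [below_count sigma l + below_count (~: sigma) l = l]. *)
Definition cycle_sign sigma : nat := \sum_(l in ~: sigma) l.

(** The component at [sigma] is supported on the single monomial T^(-1_sigma), and [w] itself sits
    at the full set. *)
Definition cycle_of w : dcx R r s := fun sigma I J a =>
  if a == expoN sigma then sgn (cycle_sign sigma) (deriv (~: sigma) w) J I else 0.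

Lemma slice_cycle_of w sigma a :
  slice (cycle_of w) sigma a =
    if a == expoN sigma then sgn (cycle_sign sigma) (deriv (~: sigma) w) else 0.
Proof.
apply/ffunP => J; apply/ffunP => I; rewrite sliceE /cycle_of.
by case: ifP => //; rewrite !ffunE.
Qed.

Lemma cycle_of_well_placed w : codegree 0 w -> well_placed (cycle_of w).
Proof.
move=> dw sigma I J a; rewrite /cycle_of; case: (a =P _) => [->|_]; last by rewrite eqxx.
rewrite !sgn_ffunE => nz.
have : deriv (~: sigma) w J I != 0 by apply: contra_neq nz => ->; rewrite sgn0.
move/(codegree_deriv dw) => IJ.
have E : #|sigma| = (#|I| + #|J|)%N.
  by apply: (@addIn #|~: sigma|); rewrite cardsC card_ord IJ.
split=> //; first by rewrite sum_expoN E.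
by move=> l lN; rewrite ffunE (negbTE lN).
Qed.

Lemma cycle_of_total w tau I J a :
  Ddiff Phi (cycle_of w) tau I J a = cech (cycle_of w) tau I J a.
Proof.
rewrite Ddiff_slice cech_slice; apply: (congr1 (fun v : zext => v J I)).
rewrite [RHS]big_mkcond; apply: eq_bigr => l _; rewrite !slice_cycle_of.
(* For [l] outside [tau] the operator d_l already occurs in [deriv (~: tau)], so the term vanishes;
   there is no Čech term for such [l]. *)
case: (boolP (l \in tau)) => lt; last first.
  case: ifP => _; last by rewrite raddf0.
  by rewrite raddf_sgn /= dcoef_deriv inE lt sgn0.
rewrite shift_expoN_eq //; case: ifP => _; last by rewrite raddf0 sgn0.
rewrite raddf_sgn /= dcoef_deriv inE lt /= !sgn_sgn.
have -> : l |: ~: tau = ~: (tau :\ l) by rewrite setCD setUC.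
rewrite /cycle_sign [in RHS](bigD1 l) /=; last by rewrite !inE eqxx.
have -> : (\sum_(i in ~: (tau :\ l) | i != l) i = \sum_(i in ~: tau) i)%N.
  apply: eq_bigl => m; rewrite !inE negb_and negbK.
  by case: (eqVneq m l) => [->|]; rewrite ?lt ?andbT.
(* Passing to [tau :\ l] adds [l] to [cycle_sign]; once [l] is split, [below_count tau l] occurs
   twice and drops out. *)
rewrite -[X in (_ + (X + _))%N](below_countC tau l) !addnA addnn -!addnA.
by rewrite -[RHS]sgn_sgn [RHS]/sgn odd_double addnC.
Qed.

(** The (0,0)-component of [cycle_of w] need not be expanded: by invariance of the diagonal
    coefficients it is read off at the full set, where no d_l is applied. *)
Lemma disguised_ri_to_koszul f w :
    codegree 0 w -> (forall J, kdiff f (w J) = 0) ->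
  disguised_ri f Phi (to_koszul w setT).
Proof.
move=> dw fw; exists (cycle_of w); split.
- exact: cycle_of_well_placed.
- exists [seq expoN sigma | sigma <- enum {set 'I_r}] => sigma I J a.
  rewrite /cycle_of; case: (a =P _) => [-> _|_]; last by rewrite eqxx.
  by apply: map_f; rewrite mem_enum.
- move=> sigma J a; rewrite (_ : [ffun I => _] = slice (cycle_of w) sigma a J).
    rewrite slice_cycle_of; case: ifP => _; last by rewrite ffunE raddf0.
    by rewrite sgn_ffunE raddf_sgn /= kdiff_deriv ?sgn0.
  by apply/ffunP => I; rewrite sliceE ffunE.
- exact: cycle_of_total.
rewrite -(diag_coef_setT (cycle_of_well_placed dw)); last exact: cycle_of_total.
rewrite /diag_coef slice_cycle_of eqxx setCT /deriv oprod0.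
by rewrite /cycle_sign big1 // => l; rewrite setCT inE.
Qed.

(** * The two inclusions *)

Lemma GammaZ_ideal_disguised_ri f y :
  GammaZ_ideal f Phi y -> disguised_ri f Phi y.
Proof.
case=> v [hv <-].
suff [w [dw fw ->]] : exists w, [/\ codegree 0 w, forall J, kdiff f (w J) = 0
    & v setT = to_koszul w setT] by exact: disguised_ri_to_koszul.
elim: hv => {v} [|c u v [j [g [z [jr [hg hj] [zh zf] ->]]]] _ [w [dw fw vw]]].
  exists 0; split=> [I J|J|]; rewrite ?raddf0 !ffunE ?eqxx ?raddf0 //.
have [b gE] := subalg_zetaJ hg.
(* The expansion of [g] may involve [J] of any size; only size [j] is kept, which gives codegree 0.
   The twist by [j] cancels the one in [to_koszul]. *)
pose w' : zext := [ffun J : {set 'I_s} =>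
  if #|J| == j then escale (c * b J) (twist j z) else 0].
exists (w' + w); split.
- move=> I J nz.
  have {nz} : (w' J I != 0) || (w J I != 0).
    apply: contraNT nz; rewrite negb_or !negbK => /andP[/eqP w'0 /eqP w0].
    by rewrite [X in fun_of_fin X I]ffunE ffunE w'0 w0 addr0.
  case/orP => [|/dw //]; rewrite ffunE; case: (#|J| =P j) => [jE|_]; last by rewrite ffunE eqxx.
  rewrite !ffunE => nz; rewrite addn0 jE (zh I) ?subnK //.
  by apply: contra_neq nz => ->; rewrite !mulr0.
- move=> J; rewrite ffunE raddfD /= fw addr0 ffunE; case: ifP => _; last by rewrite raddf0.
  by rewrite kdiff_scale (twist_homog _ zh) kdiff_scale zf !raddf0.
rewrite raddfD [RHS]ffunE -vw ffunE; congr (_ + _).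
rewrite /to_koszul gE wedge_suml raddf_sum !sum_ffunE /=; apply: eq_bigr => J _.
rewrite [w' J]ffunE wedge_scalel escaleA wedge_zetaJ; case: eqP => [jE|/eqP jE].
  by rewrite twist_scale zprod_scale jE twistK.
rewrite !raddf0 [RHS]ffunE ffunE.
(* A discarded [J] gives a product of degree [#|J| + (r - j)], different from [r], hence no top
   coefficient. *)
suff -> : zprod J z setT = 0 by rewrite mulr0.
apply: contra_neq_eq jE => /(homog_zprod zh); rewrite cardsT card_ord => E.
by apply/eqP; rewrite -(eqn_add2r (r - j)) -E subnKC.
Qed.

Lemma disguised_ri_GammaZ_ideal f y :
  disguised_ri f Phi y -> GammaZ_ideal f Phi y.
Proof.
case=> x [xW _ xf xC <-]; rewrite -(diag_coef_setT xW xC).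
(* The values of [w] are the cycles z_J multiplying eps_J T^(-1,...,-1). *)
set w := slice x setT (expoN setT).
exists (to_koszul w); split => //.
have dw J I : w J I != 0 -> (#|I| + #|J|)%N = r.
  by rewrite sliceE => /xW[<- _ _]; rewrite cardsT card_ord.
apply: big_ind => [|u v|J _]; first exact: span0.
- elim=> [|c u' v' hu _ IH] hv; first by rewrite add0r.
  by rewrite -addrA; apply: spanS => //; apply: IH.
(* On a homogeneous element the twist is a scalar sign, absorbed into the coefficient of the
   span. *)
have hw : homog (r - #|J|) (w J) by move=> I /dw /(canRL (addnK _)).
rewrite (twist_homog _ hw) zprod_scale -wedge_zetaJ.
(* When [s] exceeds [r] a set [J] can have more than [r] elements; the subtraction [r - #|J|] is
   then truncated, but [w J] is zero for degree reasons. *)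
have [Jr|Jr] := leqP #|J| r; last first.
  rewrite (_ : w J = 0); first by rewrite !raddf0; apply: span0.
  apply/ffunP => I; rewrite [RHS]ffunE; apply: contraTeq Jr => /dw E.
  by rewrite -leqNgt -E leq_addl.
rewrite -[escale _ _]addr0; apply: spanS; last exact: span0.
exists #|J|, (zetaJ J), (w J); split=> //; first exact: Gamma_zetaJ.
split=> //; rewrite -(xf setT J (expoN setT)); congr kdiff.
by apply/ffunP => I; rewrite sliceE ffunE.
Qed.

End DisguisedResidualIntersection.

Theorem theorem4p8 (R : comPzRingType) (r s : nat) (f : 'I_r -> R)
  (a : 'I_s -> R) (Phi : 'M[R]_(r, s))
  (ha : forall j : 'I_s, a j = \sum_(i < r) Phi i j * f i) :
  forall y : R, disguised_ri f Phi y <-> GammaZ_ideal f Phi y.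
Proof.
by move=> y; split; [apply: disguised_ri_GammaZ_ideal | apply: GammaZ_ideal_disguised_ri].
Qed.
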